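(* Suppose that $E\subset\mathbb R^n$ is a closed set such that $\mathcal H^n(E)=0$ and the complement $\mathbb R^n\setminus E$ is quasiconvex. Then $E$ is metrically removable (as a subset of $\mathbb R^n$ with the Euclidean metric).
   Context: A curve in a metric space $X$ is a continuous map $\gamma\colon[\alpha,\beta]\to X$; its length is the supremum over finite partitions $\{t_j\}$ of $[\alpha,\beta]$ of $\sum_j d(\gamma(t_j),\gamma(t_{j-1}))$. A set $E$ in a metric space $(X,d)$ is metrically removable if for every $\epsilon>0$, any two points $a,b\in X$ can be connected by a curve that is disjoint from $E\setminus\{a,b\}$ and has length at most $d(a,b)+\epsilon$. A set $A\subset X$ is quasiconvex if there exists a constant $C$ such that any two points $a,b\in A$ can be joined by a curve that lies in $A$ and has length at most $C\,d(a,b)$. $\mathcal H^n$ is $n$-dimensional Hausdorff measure. *)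

(* Defs.v *)
From HB Require Import structures.
From mathcomp Require Import all_boot all_order all_algebra.
From mathcomp Require Import ring.
From mathcomp Require Import all_classical all_reals all_analysis.
Set Implicit Arguments.
Unset Strict Implicit.
Unset Printing Implicit Defensive.
Import Order.TTheory GRing.Theory Num.Theory.
Import numFieldNormedType.Exports.
Local Open Scope classical_set_scope.
Local Open Scope ring_scope.

(* 'rV[R]_n carries the sup norm in MathComp-Analysis, hence an alias of it
   that is normed by the Euclidean norm and metrized accordingly. *)
Definition euclidean (R : realType) (n : nat) : Type := 'rV[R]_n.

HB.instance Definition _ (R : realType) (n : nat) :=
  GRing.Lmodule.copy (euclidean R n) 'rV[R]_n.

Definition enorm (R : realType) (n : nat) (x : euclidean R n) : R :=
  Num.sqrt (\sum_(i < n) (x : 'rV[R]_n) ord0 i ^+ 2).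

Section enorm_theory.
Context {R : realType} {n : nat}.
Implicit Types x y : euclidean R n.

Lemma cauchy_schwarz_sum (u v : 'I_n -> R) :
  (\sum_i u i * v i) ^+ 2 <= (\sum_i u i ^+ 2) * (\sum_i v i ^+ 2).
Proof.
have H : 0 <= \sum_i \sum_j (u i * v j - u j * v i) ^+ 2.
  by apply: sumr_ge0 => i _; apply: sumr_ge0 => j _; exact: sqr_ge0.
have E : \sum_i \sum_j (u i * v j - u j * v i) ^+ 2 =
    ((\sum_i u i ^+ 2) * (\sum_i v i ^+ 2) - (\sum_i u i * v i) ^+ 2) *+ 2.
  have sq i j : (u i * v j - u j * v i) ^+ 2 =
      u i ^+ 2 * v j ^+ 2 + u j ^+ 2 * v i ^+ 2 - u i * v i * (u j * v j) *+ 2.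
    by ring.
  under eq_bigr do under eq_bigr do rewrite sq.
  under eq_bigr do rewrite !(big_split, sumrN, sumrMnl)/=.
  rewrite !(big_split, sumrN, sumrMnl)/= [X in _ + X - _]exchange_big/=.
  by rewrite -!big_distrlr/= -!mulr2n -mulrnBl -expr2.
by move: H; rewrite E pmulrn_lge0// subr_ge0.
Qed.

Lemma sumsq_ge0 (u : 'I_n -> R) : 0 <= \sum_i u i ^+ 2.
Proof. by apply: sumr_ge0 => i _; exact: sqr_ge0. Qed.

Lemma ler_enormD x y : enorm (x + y) <= enorm x + enorm y.
Proof.
have ge0 := sumsq_ge0; rewrite /enorm.
rewrite -(@ler_pXn2r _ 2)// ?nnegrE ?addr_ge0 ?sqrtr_ge0//.
rewrite sqrrD !sqr_sqrtr// -sqrtrM//.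
rewrite (eq_bigr (fun i => (x : 'rV_n) ord0 i ^+ 2
  + (x : 'rV_n) ord0 i * (y : 'rV_n) ord0 i *+ 2
  + (y : 'rV_n) ord0 i ^+ 2)); last by move=> i _; rewrite mxE sqrrD.
rewrite !big_split /= lerD2r lerD2l -mulr2n lerMn2r/=.
rewrite (le_trans (ler_norm _))// -sqrtr_sqr ler_wsqrtr//.
exact: cauchy_schwarz_sum.
Qed.

Lemma enormZ (l : R) x : enorm (l *: x) = `|l| * enorm x.
Proof.
rewrite /enorm -sqrtr_sqr -sqrtrM ?sqr_ge0// mulr_sumr.
by congr Num.sqrt; apply: eq_bigr => i _; rewrite mxE exprMn.
Qed.

Lemma enorm0_eq0 x : enorm x = 0 -> x = 0.
Proof.
move=> /eqP; rewrite sqrtr_eq0 => le0.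
have /eqP : \sum_i (x : 'rV_n) ord0 i ^+ 2 = 0.
  by apply/eqP; rewrite eq_le le0 sumsq_ge0.
rewrite psumr_eq0 => [/allP x0|i _]; last exact: sqr_ge0.
apply/rowP => i; rewrite mxE; apply/eqP; rewrite -sqrf_eq0.
by apply: x0; rewrite mem_index_enum.
Qed.

HB.instance Definition _ := Lmodule_isNormed.Build R (euclidean R n)
  ler_enormD enormZ enorm0_eq0.

Let edist_ge0 x y : 0 <= `|x - y|. Proof. exact: normr_ge0. Qed.

Let edist_positivity x y : `|x - y| = 0 -> x = y.
Proof. by move/normr0_eq0/eqP; rewrite subr_eq0 => /eqP. Qed.

Let ball_edist x d : ball x d = [set y | `|x - y| < d].
Proof. by rewrite -ball_normE. Qed.

HB.instance Definition _ := PseudoMetric_isMetric.Build R (euclidean R n)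
  edist_ge0 edist_positivity ball_edist.

Lemma mdist_enormE x y : mdist x y = enorm (x - y).
Proof. by []. Qed.

End enorm_theory.

Section curves.
Context {R : realType} {X : metricType R}.
Implicit Types (gamma : R -> X) (alpha beta : R).

(* As for [variation], [alpha :: s] lists the points of the partition. *)
Definition polygonal_length alpha beta gamma (s : seq R) : R :=
  \sum_(0 <= i < size s)
    mdist (gamma (nth beta (alpha :: s) i.+1)) (gamma (nth beta (alpha :: s) i)).

Definition curve_length alpha beta gamma : \bar R :=
  ereal_sup [set (polygonal_length alpha beta gamma s)%:E
            | s in itv_partition alpha beta].

Definition curve_from_to alpha beta gamma (a b : X) : Prop :=
  [/\ alpha <= beta, {within `[alpha, beta], continuous gamma},
      gamma alpha = a & gamma beta = b].

Definition metrically_removable (E : set X) : Prop :=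
  forall eps : R, 0 < eps -> forall a b : X,
  exists alpha beta gamma,
    [/\ curve_from_to alpha beta gamma a b,
        gamma @` `[alpha, beta] `&` (E `\` [set a; b]) = set0 &
        (curve_length alpha beta gamma <= (mdist a b + eps)%:E)%E].

Definition quasiconvex (A : set X) : Prop :=
  exists C : R, forall a b : X, A a -> A b ->
  exists alpha beta gamma,
    [/\ curve_from_to alpha beta gamma a b,
        gamma @` `[alpha, beta] `<=` A &
        (curve_length alpha beta gamma <= (C * mdist a b)%:E)%E].

End curves.

Section hausdorff_measure.
Context {R : realType} {X : metricType R}.
Local Open Scope ereal_scope.

(* 0 is adjoined so that the diameter of the empty set is 0, not -oo. *)
Definition diameter (A : set X) : \bar R :=
  ereal_sup (0 |` [set (mdist x y)%:E | x in A & y in A]).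

(* The case distinction matters for n = 0 only, since x ^+ 0 = 1. *)
Definition diameter_pow (n : nat) (A : set X) : \bar R :=
  if A == set0 then 0 else diameter A ^+ n.

Definition hausdorff_content (n : nat) (delta : R) (A : set X) : \bar R :=
  ereal_inf [set \sum_(0 <= i <oo) diameter_pow n (U i) | U in
    [set U : nat -> set X |
      (forall i, diameter (U i) <= delta%:E) /\ A `<=` \bigcup_i U i]].

(* The contents grow as delta decreases to 0, so that their limit is their
   supremum. No normalizing constant is included: it does not affect which
   sets are null. *)
Definition hausdorff_measure (n : nat) (A : set X) : \bar R :=
  ereal_sup [set hausdorff_content n delta A | delta in [set d : R | (0 < d)%R]].

End hausdorff_measure.

(* Main.v *)
(* Any two points of the complement of E are joined, inside the complement, by
   a curve of length at most C times their distance. Cover the part of E in a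
   large box by finitely many balls of radii r_i with sum of r_i^n small.
   Averaging over small translates v of the segment [a, b], taken from a fine
   grid, some a + v + t(b - a) meets only balls whose radii have a small sum;
   hence the times t at which it lies in E are covered by finitely many
   intervals of small total length, and bridging these by curves in the
   complement costs little. It remains to reach a and b: they are limits of
   points outside E, and consecutive ones can be joined by curves whose lengths
   form a geometric series. Rectifiable curves are handled as 1-Lipschitz paths,
   after replacing a curve in the open complement by an inscribed polygon. *)
Require Import Defs.
From mathcomp Require Import all_boot all_order all_algebra.
From mathcomp Require Import ring lra.
From mathcomp Require Import all_classical all_reals all_analysis.
Import Order.TTheory GRing.Theory Num.Theory.
Import numFieldNormedType.Exports.
Local Open Scope classical_set_scope.

(** * Calculus of 1-Lipschitz paths inside a set *)

Section lipschitz_path.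
Local Open Scope ring_scope.
Context {R : realType} {V : normedModType R}.
Implicit Types (A B : set V) (x y z a : V) (l : R).

(** A length bound is encoded as a travel time: [f] has speed at most 1 on the whole real line, and
    only its restriction to [0, l] has to stay in [A]. Concatenation and limits then need no theory
    of curve length. *)
Definition lipschitz_path A x y l : Prop :=
  0 <= l /\ exists f : R -> V,
  [/\ forall s t, s <= t -> `|f t - f s| <= t - s, f 0 = x, f l = y &
      forall t, 0 <= t <= l -> A (f t)].

Lemma sub_lipschitz_path A B x y l : A `<=` B ->
  lipschitz_path A x y l -> lipschitz_path B x y l.
Proof.
move=> AB [l0 [f [flip f0 fl fA]]]; split=> //.
by exists f; split=> // t /fA /AB.
Qed.

(** The extra time is spent waiting at [y]. *)
Lemma lipschitz_path_le A x y l l' : l <= l' ->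
  lipschitz_path A x y l -> lipschitz_path A x y l'.
Proof.
move=> ll' [l0 [f [flip f0 fl fA]]]; split; first lra.
exists (fun t => f (Num.min t l)); split.
- move=> s t st.
  have [tl|tl] := leP t l; have [sl|sl] := leP s l; try lra.
  + by apply: flip.
  + by apply: le_trans (flip _ _ sl) _; lra.
  + by rewrite subrr normr0; lra.
- by rewrite min_l.
- by rewrite min_r.
- by move=> t t0l; apply: fA; have [] := leP t l; lra.
Qed.

Lemma lipschitz_path_cat A x y z l l' :
  lipschitz_path A x y l -> lipschitz_path A y z l' ->
  lipschitz_path A x z (l + l').
Proof.
move=> [l0 [f [flip f0 fl fA]]] [l'0 [g [glip g0 gl gA]]]; split; first lra.
exists (fun t => if t <= l then f t else g (t - l)); split.
- move=> s t st.
  have [tl|tl] := leP t l; have [sl|sl] := leP s l; try lra.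
  + exact: flip.
  + have -> : g (t - l) - f s = (g (t - l) - g 0) + (f l - f s).
      by rewrite g0 fl addrA subrK.
    apply: le_trans (ler_normD _ _) _.
    have := flip _ _ sl; have : 0 <= t - l by lra.
    by move=> /glip; lra.
  + by apply: le_trans (glip _ _ _) _; lra.
- by rewrite l0.
- have [ll|ll] := leP (l + l') l; last by rewrite addrAC subrr add0r.
  have l'E : l' = 0 by lra.
  by rewrite l'E addr0 fl -gl l'E g0.
- move=> t t0; have [tl|tl] := leP t l; first by apply: fA; lra.
  by apply: gA; lra.
Qed.

Lemma lipschitz_path_sym A x y l :
  lipschitz_path A x y l -> lipschitz_path A y x l.
Proof.
move=> [l0 [f [flip f0 fl fA]]]; split=> //.
exists (fun t => f (l - t)); split.
- move=> s t st; rewrite distrC; apply: le_trans (flip _ _ _) _; lra.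
- by rewrite subr0.
- by rewrite subrr.
- by move=> t t0; apply: fA; lra.
Qed.

Lemma lipschitz_path_segment A x y :
  (forall t, 0 <= t <= 1 -> A (x + t *: (y - x))) ->
  lipschitz_path A x y `|y - x|.
Proof.
move=> xyA; split => //; have [->|yx] := eqVneq y x.
  exists (fun=> x); split=> //; last first.
    by move=> t _; have := xyA 0; rewrite scale0r addr0; apply; lra.
  by move=> s t st; rewrite subrr normr0; lra.
have l0 : 0 < `|y - x| by rewrite normr_gt0 subr_eq0.
exists (fun t => x + (t / `|y - x|) *: (y - x)); split.
- move=> s t st; rewrite opprD addrACA subrr add0r -scalerBl normrZ -mulrBl.
  rewrite normrM [in `|_^-1|]ger0_norm ?invr_ge0// mulfVK ?gt_eqF//.
  by rewrite ger0_norm; lra.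
- by rewrite mul0r scale0r addr0.
- by rewrite divff ?gt_eqF// scale1r addrC subrK.
- move=> t /andP[t0 tl]; apply: xyA; rewrite divr_ge0//=.
  by rewrite ler_pdivrMr// mul1r.
Qed.

(** Let [F k] run through the first [k] pieces and then wait at [x k]. At a fixed time in [0, l) the
    values [F k t] are eventually constant; from time [l] on they equal [x k], which tends to [a].
    The pointwise limit inherits the Lipschitz bound. *)
Lemma lipschitz_path_lim A (x : nat -> V) a l : 0 < l ->
  (forall k, lipschitz_path A (x k) (x k.+1) (l / 2 ^+ k.+1)) ->
  x @ \oo --> a -> lipschitz_path (A `|` [set a]) (x 0%N) a l.
Proof.
move=> l0 xA xa; split; first exact: ltW.
have [g gP] := choice (fun k => (xA k).2).
pose d k : R := l / 2 ^+ k.+1.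
(* [T k] is the time at which the first [k] pieces are completed, that is, the sum of the [d i] with
   i < k. *)
pose T k : R := l - l / 2 ^+ k.
have TS k : T k.+1 = T k + d k.
  by rewrite /T /d exprS invfM; set u := (2 ^+ k)^-1; lra.
have d0 k : 0 < d k by rewrite divr_gt0 ?exprn_gt0.
have T0 k : 0 <= T k.
  by elim: k => [|k IH]; [rewrite /T expr0 divr1 subrr|rewrite TS; have := d0 k; lra].
pose F := fix F k t : V := if k is k'.+1 then
  if t <= T k' then F k' t else g k' (Num.min (t - T k') (d k')) else x 0%N.
have FS k t : F k.+1 t =
  if t <= T k then F k t else g k (Num.min (t - T k) (d k)) by [].
have F0 k : F k 0 = x 0%N by elim: k => // k IH; rewrite FS T0.
have Fx k t : T k <= t -> F k t = x k.
  case: k => [//|k]; rewrite TS FS => Tt; have dk := d0 k.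
  rewrite leNgt (_ : T k < t) /=; last lra.
  by rewrite min_r ?subr_ge0; [have [_ _ -> _] := gP k|lra].
have FA k t : 0 <= t -> A (F k t).
  elim: k => [|k IH] t0.
    by move=> /=; have [_ <- _] := gP 0%N; apply; have := d0 0%N; rewrite /d; lra.
  rewrite FS; have [tT|tT] := leP t (T k); first exact: IH.
  have [_ _ _] := gP k; apply; rewrite -/(d k).
  by have := d0 k; have [] := leP (t - T k) (d k); lra.
have Flip k s t : s <= t -> `|F k t - F k s| <= t - s.
  elim: k s t => [|k IH] s t st; first by rewrite subrr normr0; lra.
  have gk u v : 0 <= u -> u <= v ->
      `|g k (Num.min v (d k)) - g k (Num.min u (d k))| <= v - u.
    have [glip _ _ _] := gP k => u0 uv.
    have [vd|vd] := leP v (d k); have [ud|ud] := leP u (d k); try lra.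
    - exact: glip.
    - by apply: le_trans (glip _ _ ud) _; lra.
    - by rewrite subrr normr0; lra.
  have dk := d0 k.
  rewrite !FS; have [tT|tT] := leP t (T k); have [sT|sT] := leP s (T k); try lra.
  - exact: IH.
  - have -> : forall u, u - F k s =
        (u - g k (Num.min 0 (d k))) + (F k (T k) - F k s).
      move=> u; rewrite (Fx _ (T k))// min_l; last lra.
      by have [_ -> _ _] := gP k; rewrite addrA subrK.
    apply: le_trans (ler_normD _ _) _.
    have := IH _ _ sT.
    have : 0 <= t - T k by lra.
    by move=> /(gk _ _ (lexx _)); lra.
  - by apply: le_trans (gk _ _ _ _) _; lra.
have Fst t k m : t <= T k -> (k <= m)%N -> F m t = F k t.
  move=> tk; elim: m => [|m IH]; first by rewrite leqn0 => /eqP ->.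
  rewrite leq_eqVlt => /predU1P[->//|km]; rewrite FS IH//.
  suff -> : t <= T m by [].
  apply: le_trans tk _; move: km; clear -TS d0.
  elim: m => [|m IH]; first by rewrite ltnS leqn0 => /eqP ->.
  rewrite ltnS leq_eqVlt => /predU1P[->//|km]; rewrite TS.
  by apply: le_trans (IH km) _; have := d0 m; lra.
have Tex t : t < l -> exists k, t <= T k.
  move=> tl.
  have : (geometric l (2^-1 : R)) @ \oo --> (0 : R).
    by apply: cvg_geometric; rewrite ger0_norm//; lra.
  have e0 : 0 < l - t by lra.
  move=> /cvgrPdist_lt/(_ _ e0)[k _ /(_ k (leqnn k))].
  rewrite sub0r normrN /= exprVn => h; exists k; rewrite /T.
  by have := ler_norm (l / 2 ^+ k); lra.
pose Q t u := [/\ F ^~ t @ \oo --> u, t = 0 -> u = x 0%N, t = l -> u = a &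
   0 <= t <= l -> (A `|` [set a]) u].
have /choice[f fP] : forall t, exists u, Q t u.
  move=> t; have [tl|lt] := ltP t l.
    have [k tk] := Tex t tl; exists (F k t); split.
    - apply: cvg_near_cst; exists k => // m /= km; exact: Fst.
    - by move=> ->; rewrite F0.
    - by move=> tl'; move: tl; rewrite tl' ltxx.
    - by move=> /andP[t0 _]; left; exact: FA.
  exists a; split; [|by move=> t0; exfalso; lra|by []|by right].
  apply: cvg_trans xa; apply: near_eq_cvg; apply: nearW => k; rewrite Fx//.
  by rewrite /T; have : 0 < l / 2 ^+ k by [rewrite divr_gt0 ?exprn_gt0|]; lra.
exists f; split.
- move=> s t st; have [ft _ _ _] := fP t; have [fs _ _ _] := fP s.
  have h : `|F k t - F k s| @[k --> \oo] --> `|f t - f s|.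
    by apply: cvg_norm; exact: cvgB.
  rewrite -(cvg_lim _ h)//; apply: limr_le; first by apply/cvg_ex; exists `|f t - f s|.
  by apply: nearW => k /=; exact: Flip.
- by have [_ f0 _ _] := fP 0; exact: f0.
- by have [_ _ fl _] := fP l; exact: fl.
- by move=> t /[dup] t0; have [_ _ _] := fP t; apply.
Qed.

End lipschitz_path.

(** * Passage between rectifiable curves and 1-Lipschitz paths *)

Section polygonal_length.
Local Open Scope ring_scope.
Context {R : realType} {X : metricType R}.
Implicit Types (gamma : R -> X) (alpha beta : R).

Lemma polygonal_length_cons alpha beta gamma t s :
  polygonal_length alpha beta gamma (t :: s) =
  mdist (gamma t) (gamma alpha) + polygonal_length t beta gamma s.
Proof. by rewrite /polygonal_length /= big_nat_recl. Qed.

Lemma polygonal_length_nil alpha beta gamma :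
  polygonal_length alpha beta gamma [::] = 0.
Proof. by rewrite /polygonal_length big_geq. Qed.

Lemma polygonal_length_lipschitz alpha beta gamma s :
  (forall u v, u <= v -> mdist (gamma v) (gamma u) <= v - u) ->
  path <%R alpha s -> polygonal_length alpha beta gamma s <= last alpha s - alpha.
Proof.
move=> lip; elim: s alpha => [|t s IH] alpha /=.
  by rewrite polygonal_length_nil subrr.
move=> /andP[at_ /IH]; rewrite polygonal_length_cons.
by have := lip _ _ (ltW at_); lra.
Qed.

End polygonal_length.

Section curves_and_lipschitz_paths.
Local Open Scope ring_scope.
Context {R : realType} {n : nat}.
Let V := euclidean R n.
Implicit Types (A : set V) (x y : V) (gamma : R -> V) (alpha beta : R).

Lemma lipschitz_path_curve A x y (l : R) : lipschitz_path A x y l ->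
  exists alpha beta gamma,
    [/\ curve_from_to alpha beta gamma x y,
        gamma @` `[alpha, beta] `<=` A &
        (curve_length alpha beta gamma <= l%:E)%E].
Proof.
move=> [l0 [f [flip f0 fl fA]]]; exists 0, l, f; split.
- split=> //; apply: continuous_subspaceT => t.
  apply/cvgrPdist_lt => e e0; near=> u.
  suff : `|f t - f u| <= `|t - u|.
    move=> /le_lt_trans; apply; near: u.
    by apply/nbhs_ballP; exists e => //= u; rewrite -ball_normE.
  have [tu|ut] := leP t u.
    by rewrite distrC ler0_norm ?opprB ?flip//; lra.
  by rewrite [leRHS]ger0_norm ?flip//; lra.
- by move=> _ [t /= + <-]; rewrite in_itv/=; exact: fA.
- apply: ge_ereal_sup => _ [s [ps /eqP ls] <-]; rewrite lee_fin.
  by have := polygonal_length_lipschitz 0 l f s flip ps; rewrite ls subr0.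
Unshelve. all: by end_near.
Qed.

(** With u < v built in, a [path] for this relation is a partition and at the same time lists the
    vertices of an inscribed polygon lying in [A]. *)
Definition segment_in A gamma : rel R :=
  fun u v => (u < v) && `[< forall t : R, 0 <= t <= 1 ->
                               A (gamma u + t *: (gamma v - gamma u)) >].

Lemma segment_in_lipschitz_path A alpha beta gamma s :
  A (gamma alpha) -> path (segment_in A gamma) alpha s ->
  lipschitz_path A (gamma alpha) (gamma (last alpha s))
    (polygonal_length alpha beta gamma s).
Proof.
elim: s alpha => [|t s IH] alpha Aa /=.
  move=> _; rewrite polygonal_length_nil -(@normr0 _ V) -[X in `|X|](subrr (gamma alpha)).
  apply: lipschitz_path_segment => t _.
  by rewrite subrr scaler0 addr0.
move=> /andP[/andP[_ /asboolP sA] pt]; rewrite polygonal_length_cons.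
apply: (@lipschitz_path_cat _ _ _ _ (gamma t)).
  exact: lipschitz_path_segment.
by apply: IH => //; have := sA 1; rewrite scale1r addrC subrK; apply; lra.
Qed.

(** Continuity induction: the parameters reachable by such a polygon cannot stop short of [beta],
    because near each parameter all chords of the curve stay in a ball contained in [A]. *)
Lemma open_segment_in A alpha beta gamma : open A -> alpha <= beta ->
  {within `[alpha, beta], continuous gamma} -> gamma @` `[alpha, beta] `<=` A ->
  exists2 s, path (segment_in A gamma) alpha s & last alpha s = beta.
Proof.
move=> oA ab /subspace_continuousP cg gA.
have loc t : alpha <= t <= beta -> exists2 rho : R, 0 < rho &
    forall u v, alpha <= u <= beta -> alpha <= v <= beta ->
      `|t - u| < rho -> `|t - v| < rho -> u < v -> segment_in A gamma u v.
  move=> tab; have : nbhs (gamma t) A.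
    by apply: open_nbhs_nbhs; split=> //; apply: gA; exists t; rewrite //= in_itv.
  rewrite -nbhs_ballE => -[r /= r0 rA].
  have tS : `[alpha, beta]%classic t by rewrite /= in_itv.
  have /cvgrPdist_lt/(_ _ r0) := cg t tS.
  rewrite near_withinE -nbhs_ballE => -[rho /= rho0 h]; exists rho => //.
  move=> u v uab vab ut vt uv; rewrite /segment_in uv/=; apply/asboolP => c c01.
  apply: rA; rewrite -ball_normE /=.
  have du : `|gamma t - gamma u| < r.
    by apply: h; rewrite ?in_itv//= -ball_normE.
  have dv : `|gamma t - gamma v| < r.
    by apply: h; rewrite ?in_itv//= -ball_normE.
  have -> : gamma t - (gamma u + c *: (gamma v - gamma u)) =
      (1 - c) *: (gamma t - gamma u) + c *: (gamma t - gamma v).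
    rewrite scalerBl scale1r -addrA [- _ + c *: _]addrC -scalerBr opprD addrA.
    rewrite -scalerN opprB; congr (_ + c *: _).
    by rewrite opprB [RHS]addrC addrA subrK.
  apply: le_lt_trans (ler_normD _ _) _; rewrite !normrZ !ger0_norm; try lra.
  have [c0|c0] := eqVneq c 0; first by rewrite c0; lra.
  have cp : 0 < c by rewrite lt_neqAle eq_sym c0; lra.
  have := ltr_pM2l cp `|gamma t - gamma v| r; rewrite dv => /idP h1.
  have : (1 - c) * `|gamma t - gamma u| <= (1 - c) * r.
    by apply: ler_wpM2l; lra.
  by lra.
pose S := [set t | alpha <= t <= beta /\
  exists2 s, path (segment_in A gamma) alpha s & last alpha s = t].
have Sa : S alpha by split; [lra|exists [::]].
have hS : has_sup S.
  by split; [exists alpha|exists beta => t [/andP[]]].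
have mab : alpha <= sup S <= beta.
  by rewrite (ub_le_sup hS.2 Sa)/=; apply: ge_sup; [exists alpha|move=> t [/andP[]]].
have [rho rho0 h] := loc _ mab.
have [t [tab [s ps ls]] tm] := sup_adherent rho0 hS.
have tS : t <= sup S by apply: (ub_le_sup hS.2); split=> //; exists s.
(* Unless it equals [beta], [v] lies beyond [sup S]. If [t < v], one more chord puts [v] in [S],
   which forces [v = beta]; otherwise [t] itself is [beta]. *)
pose v := Num.min beta (sup S + rho / 2).
have vab : alpha <= v <= beta by rewrite /v; have [] := leP beta (sup S + rho / 2); lra.
have [tv|vt] := ltP t v.
  have Sv : S v.
    split=> //; exists (rcons s v); last by rewrite last_rcons.
    rewrite rcons_path ps ls /=; apply: h => //; rewrite ltr_norml.
      by lra.
    by move: tv; rewrite /v; have [] := leP beta (sup S + rho / 2); lra.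
  have vS := ub_le_sup hS.2 Sv.
  have vb : v = beta by move: vS; rewrite /v; have [] := leP beta (sup S + rho / 2); lra.
  by move: Sv => [_]; rewrite vb.
exists s => //; rewrite ls.
by move: vt; rewrite /v; have [] := leP beta (sup S + rho / 2); lra.
Qed.

(** An inscribed polygon is no longer than the curve, so it inherits the bound. The maximum with 1
    makes the constant positive. *)
Lemma quasiconvex_lipschitz_path A : open A -> quasiconvex A ->
  exists2 C : R, 0 < C &
    forall x y, A x -> A y -> lipschitz_path A x y (C * `|y - x|).
Proof.
move=> oA [C hC]; exists (Num.max C 1); first by have [] := leP C 1; lra.
move=> x y Ax Ay.
have [alpha [beta [gamma [[ab cg <- <-] gA len]]]] := hC x y Ax Ay.
have [s ps ls] := open_segment_in A alpha beta gamma oA ab cg gA.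
have Aa : A (gamma alpha) by apply: gA; exists alpha; rewrite //= in_itv/= lexx.
have := segment_in_lipschitz_path A alpha beta gamma s Aa ps; rewrite ls.
apply: lipschitz_path_le; rewrite -lee_fin.
apply: (@le_trans _ _ (curve_length alpha beta gamma)).
  apply: ereal_sup_ubound; exists s => //; split; last by rewrite ls.
  by apply: sub_path ps => u v /andP[].
apply: le_trans len _; rewrite lee_fin mdist_enormE.
rewrite -[enorm _]/(`|gamma alpha - gamma beta|) distrC.
by apply: ler_wpM2r => //; rewrite le_max lexx.
Qed.

End curves_and_lipschitz_paths.

(** * Following a line and bridging the intervals where it may meet the closed set *)

Definition total_length {R : realType} (s : seq (R * R)) : R :=
  (\sum_(I <- s) (I.2 - I.1))%R.

Section path_along_line.
Local Open Scope ring_scope.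
Context {R : realType} {V : normedModType R}.
Variables (E : set V) (C : R) (a d : V).
Hypothesis C0 : 0 < C.
Hypothesis bridge : forall x y : V, ~ E x -> ~ E y ->
  lipschitz_path (~` E) x y (C * `|y - x|).

Let line (t : R) := a + t *: d.

Let line_sub s t : line t - line s = (t - s) *: d.
Proof. by rewrite /line opprD addrACA subrr add0r -scalerBl. Qed.

Lemma path_along_free_segment p q : p <= q ->
  (forall t, p <= t <= q -> ~ E (line t)) ->
  lipschitz_path (~` E) (line p) (line q) (`|d| * (q - p)).
Proof.
move=> pq pqE.
have -> : `|d| * (q - p) = `|line q - line p|.
  by rewrite line_sub normrZ mulrC ger0_norm ?subr_ge0.
apply: lipschitz_path_segment => t t01; rewrite line_sub scalerA.
rewrite {1}/line -addrA -scalerDl; apply: pqE.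
have : 0 <= t * (q - p) by apply: mulr_ge0; lra.
have : t * (q - p) <= 1 * (q - p) by apply: ler_wpM2r; lra.
by lra.
Qed.

(* Open intervals make the induction work: if the right end of the leftmost
   interval is in [E], then another interval contains it and the two can be
   merged; otherwise the leftmost interval can be bridged. *)
Lemma path_along_line s p q : p <= q -> ~ E (line p) -> ~ E (line q) ->
  sorted (fun I J : R * R => I.1 <= J.1) s -> all (fun I => I.1 < I.2) s ->
  (forall t, p <= t <= q -> E (line t) -> exists2 I, I \in s & I.1 < t < I.2) ->
  lipschitz_path (~` E) (line p) (line q) (`|d| * (q - p + C * total_length s)).
Proof.
pose r (I J : R * R) := I.1 <= J.1.
have rtr : transitive r by move=> x y z; exact: le_trans.
have len_ge0 (s' : seq (R * R)) : all (fun I => I.1 < I.2) s' -> 0 <= total_length s'.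
  move=> /allP h; rewrite /total_length big_seq; apply: sumr_ge0 => I /h.
  by rewrite subr_ge0 => /ltW.
have [m] := ubnP (size s); elim: m s p q => // m IH [|[l u] s] p q /=.
  move=> _ pq pE qE _ _ cov; rewrite /total_length big_nil mulr0 addr0.
  by apply: path_along_free_segment => // t tpq /(cov _ tpq)[].
rewrite ltnS => sm pq pE qE ls /andP[lu sP] cov.
have lenE : total_length ((l, u) :: s) = u - l + total_length s.
  by rewrite /total_length big_cons.
have ls0 := len_ge0 s sP.
have lmin I : I \in s -> l <= I.1.
  by have /allP := order_path_min rtr ls; exact.
have ss : sorted r s := path_sorted ls.
have [disj|] := pselect (u <= p \/ q <= l).
  apply: lipschitz_path_le (IH s p q sm pq pE qE ss sP _).
    by apply: ler_wpM2l => //; rewrite lerD2l ler_wpM2l ?(ltW C0)// lenE; clear disj; lra.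
  move=> t tpq Et; have [I] := cov t tpq Et.
  rewrite in_cons => /predU1P[->/=|]; last by exists I.
  move=> ltu; case: disj => [up|ql].
    have tp : t = p by lra.
    by case: pE; rewrite -tp.
  have tq : t = q by lra.
  by case: qE; rewrite -tq.
move=> /not_orP[/negP + /negP]; rewrite -!ltNge => pu lq.
have [[uq Eu]|nu] := pselect (u <= q /\ E (line u)).
  have [|J] := cov u _ Eu; first lra.
  rewrite in_cons => /predU1P[->/=|Js Ju]; first by rewrite ltxx andbF.
  have JP := allP sP _ Js.
  have remsub : subseq (rem J s) s := rem_subseq J s.
  have lenJ : total_length s = J.2 - J.1 + total_length (rem J s).
    by rewrite /total_length (big_rem J).
  have srem : (size (rem J s)).+1 = size s.
    by rewrite size_rem// prednK//; case: (s) Js.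
  (* Merging does not increase the total length because [J.1 < u]. *)
  apply: lipschitz_path_le (IH ((l, J.2) :: rem J s) p q _ pq pE qE _ _ _).
  - apply: ler_wpM2l => //; rewrite lenE lenJ.
    rewrite /total_length big_cons /= -/(total_length _).
    rewrite lerD2l ler_pM2l//; lra.
  - by rewrite /= srem.
  - rewrite /= path_min_sorted; first exact: subseq_sorted remsub ss.
    by apply/allP => I /(mem_subseq remsub) /lmin.
  - apply/andP; split; first by rewrite /=; lra.
    by apply/allP => I /(mem_subseq remsub) Is; exact: (allP sP).
  - move=> t tpq Et; have [I] := cov t tpq Et.
    rewrite in_cons => /predU1P[->/= tlu|Is tI].
      by exists (l, J.2); rewrite ?mem_head//=; lra.
    have [IJ|IJ] := eqVneq I J.
      exists (l, J.2); rewrite ?mem_head//=.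
      by have := lmin _ Js; move: tI; rewrite IJ; lra.
    exists I => //; rewrite in_cons; apply/orP; right.
    by move: Is; rewrite (perm_mem (perm_to_rem Js)) in_cons (negbTE IJ).
(* The leftmost interval is clipped to [p, q]. Before [l'] the line avoids [E], as no interval
   starts to the left of [l]; at [u'] it avoids [E] by [nu] or because [u' = q]. So the path goes
   straight to [l'], takes a bridge to [u'], and continues by induction. *)
pose l' := Num.max p l; pose u' := Num.min u q.
have l'P : [/\ p <= l', l <= l', l' < u & l' <= q].
  by rewrite /l'; have [] := leP p l; split; lra.
have u'P : [/\ u' <= u, u' <= q, l < u' & p <= u'].
  by rewrite /u'; have [] := leP u q; split; lra.
case: l'P => pl' ll' l'u l'q; case: u'P => u'u u'q lu' pu'.
have l'u' : l' <= u' by rewrite /u' le_min l'q ltW.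
have free t : p <= t <= l' -> ~ E (line t).
  move=> tpl Et; have [|I Is It] := cov t _ Et; first lra.
  have lI : l <= I.1.
    by move: Is; rewrite in_cons => /predU1P[->//|/lmin].
  have tp : t = p by move: tpl It; rewrite /l'; have [] := leP p l; lra.
  by apply: pE; rewrite -tp.
have l'E : ~ E (line l') by apply: free; lra.
have u'E : ~ E (line u').
  rewrite /u'; have [uq|qu] := leP u q; last exact: qE.
  by move=> Eu; apply: nu.
have P1 := path_along_free_segment p l' pl' free.
have P2 := bridge _ _ l'E u'E.
have P3 : lipschitz_path (~` E) (line u') (line q) (`|d| * (q - u' + C * total_length s)).
  apply: IH => // t tu'q Et; have [|I] := cov t _ Et; first lra.
  rewrite in_cons => /predU1P[->/= tlu|Is tI]; last by exists I.
  have tq : t = q by move: tu'q; rewrite /u'; have [] := leP u q; lra.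
  by case: qE; rewrite -tq.
have := lipschitz_path_cat _ _ _ _ _ _ (lipschitz_path_cat _ _ _ _ _ _ P1 P2) P3.
apply: lipschitz_path_le; rewrite line_sub normrZ ger0_norm ?subr_ge0// lenE.
have -> : `|d| * (l' - p) + C * ((u' - l') * `|d|) + `|d| * (q - u' + C * total_length s)
  = `|d| * (l' - p + C * (u' - l') + (q - u' + C * total_length s)) by ring.
apply: ler_wpM2l => //; rewrite mulrDr.
have : C * (u' - l') <= C * (u - l) by rewrite ler_pM2l// lerB.
by move: l'u'; clear; lra.
Qed.

End path_along_line.

(** * Choosing a good translate by averaging over a grid *)

Section grid_averaging.
Local Open Scope ring_scope.
Context {R : realType}.

(** The increments of [phi] telescope and its values lie in [0, L + 1], so at most L + 1 points are
    counted. *)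
Lemma count_grid_points (h y rho : R) (N : nat) : 0 < h -> 0 <= rho ->
  \sum_(i < N) (`|i%:R * h - y| < rho)%R%:R <= 2 * rho / h + 1.
Proof.
move=> h0 rho0; pose L := 2 * rho / h; pose c := (y - rho) / h.
have L0 : 0 <= L by rewrite divr_ge0 ?mulr_ge0 ?(ltW h0).
(* [phi] is nondecreasing and grows by 1 at each counted grid point *)
pose phi (i : nat) : R := Num.max 0 (Num.min (i%:R - c) (L + 1)).
have phiE i : [\/ phi i = 0 /\ i%:R - c <= 0,
    phi i = i%:R - c /\ 0 <= i%:R - c <= L + 1 |
    phi i = L + 1 /\ L + 1 <= i%:R - c].
  rewrite /phi; have [h1|h1] := leP (i%:R - c) (L + 1).
    by have [h2|h2] := leP 0 (i%:R - c);
      [apply: Or32|apply: Or31]; split => //; lra.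
  by rewrite (max_r (_ : 0 <= L + 1)); [apply: Or33; split=> //|]; lra.
apply: (@le_trans _ _ (\sum_(0 <= i < N) (phi i.+1 - phi i))).
  rewrite big_mkord; apply: ler_sum => i _.
  have iS : i.+1%:R = i%:R + 1 :> R by rewrite -natr1.
  have := phiE i.+1; have := phiE i; rewrite iS.
  case: (boolP (`|i%:R * h - y| < rho)) => [|_] /=;
    last by move=> [] [-> ?] [] [-> ?]; lra.
  rewrite ltr_norml => /andP[lo hi].
  have ic : 0 < i%:R - c.
    by rewrite subr_gt0 /c ltr_pdivrMr//; lra.
  have iL : i%:R - c < L.
    rewrite ltrBlDr /L /c -mulrDl ltr_pdivlMr//; lra.
  by move=> [] [-> ?] [] [-> ?]; lra.
rewrite telescope_sumr// -/L.
by case: (phiE N) => -[-> ?]; case: (phiE 0%N) => -[-> ?]; lra.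
Qed.

(** On a grid of [N] points with spacing h = delta / N, the term [B] is counted at most 4 r / h + 1
    times, hence at most 5 r / h times once h <= r. Some grid point does no worse than the mean. *)
Lemma grid_averaging1 (T : eqType) (F : seq T) (y r w : T -> R) (delta : R) :
  (forall B, 0 < r B) -> (forall B, 0 <= w B) -> 0 < delta ->
  exists2 v, 0 <= v <= delta &
    \sum_(B <- F | `|v - y B| < 2 * r B) w B <=
    5 / delta * \sum_(B <- F) w B * r B.
Proof.
move=> r0 w0 delta0.
(* The list [F] is finite, so a single spacing lies below all its radii. *)
have [N N0 Nr] : exists2 N, (0 < N)%N & forall B, B \in F -> delta / N%:R <= r B.
  elim: F => [|B F [N N0 IH]]; first by exists 1%N.
  exists (maxn N (Num.bound (delta / r B))); first by rewrite leq_max N0.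
  have M0 : 0 < (maxn N (Num.bound (delta / r B)))%:R :> R.
    by rewrite ltr0n leq_max N0.
  move=> B'; rewrite in_cons => /predU1P[->|/IH].
    rewrite ler_pdivrMr// mulrC -ler_pdivrMr//.
    apply: ltW; apply: lt_le_trans (archi_boundP _) _.
      by rewrite divr_ge0// ltW.
    by rewrite ler_nat leq_maxr.
  have NR0 : 0 < N%:R :> R by rewrite ltr0n.
  apply: le_trans; rewrite ler_pM2l// lef_pV2 ?posrE//.
  by rewrite ler_nat leq_maxl.
have NR0 : 0 < N%:R :> R by rewrite ltr0n.
pose h := delta / N%:R; have h0 : 0 < h by rewrite divr_gt0.
pose G v := \sum_(B <- F | `|v - y B| < 2 * r B) w B.
pose rhs := 5 / delta * \sum_(B <- F) w B * r B.
have sumG : \sum_(i < N) G (i%:R * h) <= N%:R * rhs.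
  under eq_bigr => i _ do rewrite /G big_mkcond/=.
  rewrite exchange_big /= /rhs mulr_sumr mulr_sumr.
  rewrite big_seq [leRHS]big_seq.
  apply: ler_sum => B BF.
  have -> : \sum_(i < N) (if `|i%:R * h - y B| < 2 * r B then w B else 0) =
      w B * \sum_(i < N) (`|i%:R * h - y B| < 2 * r B)%R%:R.
    by rewrite mulr_sumr; apply: eq_bigr => i _; case: ifP; rewrite ?mulr1 ?mulr0.
  have -> : N%:R * (5 / delta * (w B * r B)) = w B * (5 * r B / h).
    by rewrite /h; field; rewrite !gt_eqF.
  apply: ler_wpM2l => //; have rB := r0 B.
  apply: le_trans (count_grid_points _ _ _ _ h0 _) _; first lra.
  have : 1 <= r B / h by rewrite ler_pdivlMr// mul1r; exact: Nr.
  by lra.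
have [[i iG]|nG] := pselect (exists i : 'I_N, G (i%:R * h) <= rhs).
  exists (i%:R * h) => //; rewrite mulr_ge0 ?(ltW h0)//=.
  rewrite /h mulrA ler_pdivrMr// mulrC ler_pM2l// ler_nat.
  exact: ltnW.
suff : N%:R * rhs < \sum_(i < N) G (i%:R * h) by rewrite ltNge sumG.
have -> : N%:R * rhs = \sum_(i < N) rhs by rewrite sumr_const card_ord mulr_natl.
apply: ltr_sum => [|i _]; first by apply/hasP;
  exists (Ordinal N0); rewrite ?mem_index_enum.
by rewrite ltNge; apply/negP => iG; apply: nG; exists i.
Qed.

(** Coordinates are chosen one at a time. The first choice uses the weight [w B * r B ^+ size js],
    which already contains the powers that the remaining coordinates will produce; the induction
    then runs on the terms of [F] that survive. *)
Lemma grid_averaging (T J : eqType) (js : seq J) (F : seq T) (y : T -> J -> R)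
    (r w : T -> R) (delta : R) :
  (forall B, 0 < r B) -> (forall B, 0 <= w B) -> 0 < delta -> uniq js ->
  exists v : J -> R, [/\ forall j, 0 <= v j <= delta,
    forall j, j \notin js -> v j = 0 &
    \sum_(B <- F | all (fun j => `|v j - y B j| < 2 * r B) js) w B <=
    (5 / delta) ^+ size js * \sum_(B <- F) w B * r B ^+ size js].
Proof.
move=> r0 w0 delta0; elim: js F => [|j js IH] F /=.
  exists (fun=> 0); split=> // [j|]; first by rewrite lexx ltW.
  by rewrite expr0 mul1r; under [leRHS]eq_bigr do rewrite expr0 mulr1.
move=> /andP[jjs ujs].
have wr B : 0 <= w B * r B ^+ size js by rewrite mulr_ge0// exprn_ge0// ltW.
have [vj vj0 avg] := grid_averaging1 _ F (y^~ j) _ _ _ r0 wr delta0.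
have [v [v0 vjs vF]] := IH [seq B <- F | `|vj - y B j| < 2 * r B] ujs.
exists (fun i => if i == j then vj else v i); split.
- by move=> i; case: eqP.
- by move=> i; rewrite in_cons negb_or => /andP[/negbTE -> /vjs].
rewrite eqxx.
have -> : \sum_(B <- F | (`|vj - y B j| < 2 * r B) &&
    all (fun i => `|(if i == j then vj else v i) - y B i| < 2 * r B) js) w B =
  \sum_(B <- [seq B <- F | `|vj - y B j| < 2 * r B] |
    all (fun i => `|v i - y B i| < 2 * r B) js) w B.
  rewrite big_filter_cond; apply: eq_bigl => B; congr andb.
  apply: eq_in_all => i ijs; case: eqP => // ij.
  by move: jjs; rewrite -ij ijs.
apply: le_trans vF _; rewrite exprSr -mulrA; apply: ler_wpM2l.
  by rewrite exprn_ge0// divr_ge0// ltW.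
rewrite big_filter; under [X in _ <= _ * X]eq_bigr do rewrite exprSr mulrA.
exact: avg.
Qed.

End grid_averaging.

(** * Coordinates and compact boxes in Euclidean space *)

Section euclidean_coordinates.
Local Open Scope ring_scope.
Context {R : realType} {n : nat}.
Implicit Types x : euclidean R n.

Definition coord_at x (i : 'I_n) : R := (x : 'rV[R]_n) ord0 i.

Lemma norm_coord_at x i : `|coord_at x i| <= `|x|.
Proof.
rewrite -[`|x|]/(enorm x) /enorm -sqrtr_sqr ler_wsqrtr// (bigD1 i)//=.
by rewrite lerDl; apply: sumr_ge0 => j _; exact: sqr_ge0.
Qed.

Lemma norm_le_sum_coord_at x : `|x| <= \sum_i `|coord_at x i|.
Proof.
have sum0 : 0 <= \sum_i `|coord_at x i| by apply: sumr_ge0.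
rewrite -[`|x|]/(enorm x) /enorm -[leRHS]ger0_norm// -sqrtr_sqr ler_wsqrtr//.
rewrite expr2 mulr_suml; apply: ler_sum => i _.
rewrite -real_normK ?num_real// expr2; apply: ler_wpM2l => //.
by rewrite (bigD1 i)//= lerDl; apply: sumr_ge0.
Qed.

(** The box is compact for the sup norm on row vectors, and the identity map to the Euclidean copy
    is continuous since the Euclidean norm is at most the sum of the absolute coordinates. *)
Lemma compact_box (M : R) :
  compact [set x : euclidean R n | forall i, `|coord_at x i| <= M].
Proof.
pose box := [set x : 'rV[R]_n | forall i, `[- M, M]%classic (x ord0 i)].
have cbox : compact box.
  by apply: (@rV_compact _ n (fun=> `[- M, M]%classic)) => _; exact: segment_compact.
pose f (x : 'rV[R]_n) : euclidean R n := x.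
have cf : continuous f.
  move=> x; apply/(@cvgrPdist_lt _ _ _ _ (nbhs_filter x)) => e e0.
  (* Dividing by [n.+1] instead of [n] covers [n = 0] and makes the final inequality strict. *)
  have n0 : 0 < n.+1%:R :> R by rewrite ltr0n.
  apply/nbhs_ballP; exists (e / n.+1%:R) => /=; first by rewrite divr_gt0.
  move=> y [_ xy]; apply: le_lt_trans (norm_le_sum_coord_at _) _.
  apply: (@le_lt_trans _ _ (\sum_(i < n) (e / n.+1%:R))).
    apply: ler_sum => i _; rewrite /coord_at !mxE.
    by have := xy ord0 i; rewrite -ball_normE /= => /ltW.
  rewrite sumr_const card_ord -[ltLHS]mulr_natr mulrAC ltr_pdivrMr//.
  by rewrite ltr_pM2l// ltr_nat.
have -> : [set x : euclidean R n | forall i, `|coord_at x i| <= M] = f @` box.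
  apply/seteqP; split=> [x xM|_ [x xM <-] i].
    by exists x => // i; rewrite /= in_itv/= -ler_norml; exact: xM.
  by rewrite ler_norml; have := xM i; rewrite /= in_itv.
by apply: continuous_compact => //; exact: continuous_subspaceT.
Qed.

End euclidean_coordinates.

(** * Covering null sets by balls with a small sum of powers of radii *)

Section null_sets.
Local Open Scope ring_scope.
Context {R : realType} {n : nat}.
Variable E : set (euclidean R n).
Hypothesis clE : closed E.
Hypothesis nullE : hausdorff_measure n E = 0%E.
Hypothesis n0 : (0 < n)%N.

Lemma exprD_le (x y : R) (k : nat) : 0 <= x -> 0 <= y ->
  (x + y) ^+ k <= 2 ^+ k * (x ^+ k + y ^+ k).
Proof.
move=> x0 y0.
have h (u v : R) : 0 <= u <= v -> (u + v) ^+ k <= 2 ^+ k * (u ^+ k + v ^+ k).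
  move=> uv; apply: (@le_trans _ _ ((2 * v) ^+ k)).
    by apply: lerXn2r; rewrite ?nnegrE; lra.
  by rewrite exprMn ler_wpM2l ?exprn_ge0// lerDr exprn_ge0//; lra.
have [xy|yx] := leP x y; first by apply: h; rewrite x0.
by rewrite addrC [X in _ * X]addrC; apply: h; rewrite y0 ltW.
Qed.

(** Covering sets of small content are replaced by open balls centred at one of their points. The
    summable slack [s i] added to the diameter makes the radii positive and the inclusion in the
    open ball strict. *)
Lemma null_set_cover (c : R) : 0 < c ->
  exists (x : nat -> euclidean R n) (r : nat -> R),
  [/\ forall i, 0 < r i,
      E `<=` \bigcup_i [set z | `|x i - z| < r i] &
      forall k, \sum_(i < k) r i ^+ n <= c].
Proof.
(* [exprD_le] costs a factor 2 ^ n, and two sums, of [d i ^+ n] and of [s i], are each at most [c'].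
   The bound 1 gives [s i <= 1], hence [s i ^+ n <= s i]. *)
move=> c0; pose c' := Num.min 1 (c / 2 ^+ n.+1).
have c'0 : 0 < c' by rewrite lt_min ltr01 divr_gt0 ?exprn_gt0.
have : (hausdorff_content n 1 E < c'%:E)%E.
  apply: (@le_lt_trans _ _ 0%E); last by rewrite lte_fin.
  by rewrite -nullE; apply: ereal_sup_ubound; exists 1 => //=.
move=> /ereal_inf_lt[_ [U [Ud UE] <-] Uc'].
have d0 i : (0 <= diameter (U i))%E by apply: ereal_sup_ubound; left.
have dfin i : diameter (U i) \is a fin_num.
  by rewrite ge0_fin_numE// (le_lt_trans (Ud i))// ltry.
pose d i := fine (diameter (U i)).
have dE i : diameter (U i) = (d i)%:E by rewrite /d fineK.
have d_ge0 i : 0 <= d i by rewrite -lee_fin -dE.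
have Ui i z y : U i z -> U i y -> `|z - y| <= d i.
  move=> Uz Uy; rewrite -lee_fin -dE; apply: ereal_sup_ubound; right.
  by exists z => //; exists y.
have powE i : (((d i) ^+ n)%:E <= diameter_pow n (U i))%E.
  rewrite /diameter_pow; case: eqP => [U0|_]; last by rewrite dE EFin_expe.
  suff -> : d i = 0 by rewrite expr0n gtn_eqF.
  rewrite /d /diameter U0 (_ : [set _ | _ in set0 & _ in _] = set0).
    by rewrite setU0 ereal_sup1.
  by apply/seteqP; split=> // _ [? []].
pose s i : R := c' / 2 ^+ i.+1.
have s0 i : 0 < s i by rewrite divr_gt0 ?exprn_gt0.
have s1 i : s i <= 1.
  rewrite ler_pdivrMr ?exprn_gt0// mul1r (@le_trans _ _ 1)//.
    by rewrite /c' ge_min lexx.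
  by rewrite exprn_ege1// ler1n.
have ssum k : \sum_(i < k) s i = c' - c' / 2 ^+ k.
  elim: k => [|k IH]; first by rewrite big_ord0 expr0 divr1 subrr.
  rewrite big_ord_recr IH /s /= exprS invfM; set u := (2 ^+ k)^-1; lra.
(* An empty [U i] gets the default centre 0; its ball is harmless. *)
exists (fun i => xget 0 (U i)), (fun i => d i + s i); split.
- by move=> i; rewrite ltr_wpDl.
- move=> z /UE[i _ Uz]; exists i => //=.
  apply: le_lt_trans (Ui i _ _ _ Uz) _; last by rewrite ltrDl.
  exact: (@xgetPex _ 0 (U i)) (ex_intro _ z Uz).
- move=> k; apply: (@le_trans _ _ (2 ^+ n * (\sum_(i < k) d i ^+ n + \sum_(i < k) s i))).
    rewrite -big_split mulr_sumr; apply: ler_sum => i _ /=.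
    apply: le_trans (exprD_le _ _ _ (d_ge0 i) (ltW (s0 i))) _.
    rewrite ler_wpM2l ?exprn_ge0// lerD2l -[leRHS]expr1.
    by apply: ler_wiXn2l; rewrite ?s1 ?(ltW (s0 i)).
  have dk : \sum_(i < k) d i ^+ n <= c'.
    rewrite -lee_fin -sumEFin; apply: le_trans (ltW Uc').
    apply: (@le_trans _ _ (\sum_(0 <= i < k) diameter_pow n (U i))%E).
      by rewrite big_mkord; apply: lee_sum => i _; exact: powE.
    apply: nneseries_lim_ge => i _ _; apply: le_trans (powE i).
    by rewrite lee_fin exprn_ge0.
  have sk : \sum_(i < k) s i <= c'.
    by rewrite ssum lerBlDr lerDl divr_ge0// ?exprn_ge0// ltW.
  have c'c : c' <= c / 2 ^+ n.+1 by rewrite /c' ge_min lexx orbT.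
  apply: (@le_trans _ _ (2 ^+ n * (2 * (c / 2 ^+ n.+1)))).
    by rewrite ler_wpM2l ?exprn_ge0//; lra.
  by rewrite mulrA -exprSr mulrC divfK// gt_eqF ?exprn_gt0.
Qed.

(** Compactness leaves finitely many balls, all among the first [K], and every partial sum of the
    cover is already bounded by [c]. *)
Lemma null_set_box_cover (M c : R) : 0 < c ->
  exists (x : nat -> euclidean R n) (r : nat -> R) (K : nat),
  [/\ forall i, 0 < r i,
      forall z, E z -> (forall j, `|coord_at z j| <= M) ->
        exists2 i, (i < K)%N & `|z - x i| < r i &
      \sum_(0 <= i < K) r i ^+ n <= c].
Proof.
move=> /null_set_cover[x [r [r0 Er rc]]].
have := @compact_closedI _ _ _ (@compact_box R n M) clE.
rewrite compact_cover => /(_ nat setT (fun i => ball (x i) (r i))).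
case=> [i _||D _ DE].
- exact: ball_open.
- by move=> z [_ /Er[i _ zr]]; exists i => //; rewrite -ball_normE.
exists x, r, (\max_(i <- finmap.enum_fset D) i.+1)%N; split=> // [z Ez zM|].
  have [|i /= iD] := DE z; first by split.
  rewrite -ball_normE /= distrC => zr; exists i => //.
  exact: (@leq_bigmax_seq _ (finmap.enum_fset D) xpredT S i iD isT).
by rewrite big_mkord; exact: rc.
Qed.

End null_sets.

(** * Translated lines that meet a null set only for a short time *)

Section null_sets_and_lines.
Local Open Scope ring_scope.
Context {R : realType} {n : nat}.
Let V := euclidean R n.
Variable E : set V.
Hypothesis clE : closed E.
Hypothesis nullE : hausdorff_measure n E = 0%E.

Lemma coord_atD (x y : V) i : coord_at (x + y) i = coord_at x i + coord_at y i.
Proof. by rewrite /coord_at mxE. Qed.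

Lemma coord_atB (x y : V) i : coord_at (x - y) i = coord_at x i - coord_at y i.
Proof. by rewrite /coord_at !mxE. Qed.

Lemma coord_atZ (t : R) (x : V) i : coord_at (t *: x) i = t * coord_at x i.
Proof. by rewrite /coord_at mxE. Qed.

(** This coordinate serves as a clock along the line; its maximality controls the drift of the
    others. *)
Lemma largest_coord_at (d : V) : d != 0 ->
  exists2 k, 0 < `|coord_at d k| & forall j, `|coord_at d j| <= `|coord_at d k|.
Proof.
move=> d0; have [i di] : exists i, coord_at d i != 0.
  apply/not_existsP => h; case/eqP: d0; apply/rowP => i; rewrite mxE.
  by apply/eqP; apply: contrapT => /negP /h.
have [k _ kmax] := @Order.TotalTheory.arg_maxP _ _ _ i xpredT
  (fun i => `|coord_at d i|) isT.
exists k => [|j]; last exact: kmax.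
by apply: lt_le_trans (kmax i isT); rewrite normr_gt0.
Qed.

(** The shift [v] leaves coordinate [k] alone. If the shifted line is in ball [i] at time [t],
    coordinate [k] puts [t] within [r i / m] of [c i], and then every other [v] coordinate is within
    [2 * r i] of [y i j]. Averaging over these n - 1 coordinates with weight [r i] bounds the radii
    of the balls hit by a multiple of the sum of [r i ^+ n]. *)
Lemma null_set_line_cover (a d : V) (eta : R) : d != 0 -> 0 < eta ->
  exists (v : V) (s : seq (R * R)),
  [/\ `|v| <= eta, all (fun I => I.1 < I.2) s, total_length s <= eta &
      forall t, 0 <= t <= 1 -> E (a + v + t *: d) ->
        exists2 I, I \in s & I.1 < t < I.2].
Proof.
move=> d0 eta0; have [k m0 kmax] := largest_coord_at d d0.
set m := `|coord_at d k| in m0 kmax.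
have n0 : (0 < n)%N by apply: leq_ltn_trans (ltn_ord k).
have nR0 : 0 < n%:R :> R by rewrite ltr0n.
(* The [n] coordinates of [v] then add up to at most [eta], and to at most 1, which keeps the
   segment in the box of size [|a| + 1 + |d|]. *)
pose delta := Num.min eta 1 / n%:R.
have delta0 : 0 < delta by rewrite divr_gt0// lt_min eta0 ltr01.
pose js := [seq j <- enum 'I_n | j != k].
have ujs : uniq js by rewrite filter_uniq// enum_uniq.
have jsE j : (j \in js) = (j != k) by rewrite mem_filter mem_enum andbT.
have szjs : (size js).+1 = n.
  have -> : js = rem k (enum 'I_n) by rewrite rem_filter// enum_uniq.
  by rewrite size_rem ?mem_enum// size_enum_ord prednK.
(* [K0] is the total loss: 2 / m from the lengths of the intervals, the power from averaging. Hence
   the cover is taken with bound [eta / K0]. *)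
pose K0 := 2 / m * (5 / delta) ^+ size js.
have K00 : 0 < K0 by apply: mulr_gt0; rewrite ?exprn_gt0// divr_gt0.
have [x [r [K [r0 cov sumr]]]] :=
  null_set_box_cover E clE nullE n0 (`|a| + 1 + `|d|) _ (divr_gt0 eta0 K00).
(* At time [c i] the line agrees with the centre [x i] in coordinate [k]; [y i j] is the shift that
   makes them agree in coordinate [j] too. *)
pose c i := (coord_at (x i) k - coord_at a k) / coord_at d k.
pose y i j := coord_at (x i) j - coord_at a j - c i * coord_at d j.
have [vc [vc0 vck vsum]] := grid_averaging _ _ js (index_iota 0 K) y r r delta r0
  (fun i => ltW (r0 i)) delta0 ujs.
pose v : V := \row_j vc j.
have vE j : coord_at v j = vc j by rewrite /coord_at mxE.
have vmin : `|v| <= Num.min eta 1.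
  apply: le_trans (norm_le_sum_coord_at _) _.
  apply: (@le_trans _ _ (\sum_(i < n) delta)).
    by apply: ler_sum => j _; rewrite vE ger0_norm; have := vc0 j; lra.
  by rewrite sumr_const card_ord -[leLHS]mulr_natr /delta divfK ?gt_eqF.
have veta : `|v| <= eta by apply: le_trans vmin _; rewrite ge_min lexx.
have v1 : `|v| <= 1 by apply: le_trans vmin _; rewrite ge_min lexx orbT.
pose hit i := all (fun j => `|vc j - y i j| < 2 * r i) js.
pose itv i := (c i - r i / m, c i + r i / m).
have rm i : 0 < r i / m by rewrite divr_gt0.
exists v, [seq itv i | i <- index_iota 0 K & hit i]; split => //.
- by apply/allP => _ /mapP[i _ ->] /=; have := rm i; lra.
- rewrite /total_length big_map big_filter /=.
  have -> : \sum_(0 <= i < K | hit i) (c i + r i / m - (c i - r i / m)) =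
      2 / m * \sum_(0 <= i < K | hit i) r i.
    by rewrite mulr_sumr; apply: eq_bigr => i _; field; rewrite gt_eqF.
  apply: (@le_trans _ _ (K0 * (eta / K0))); last by rewrite mulrC divfK ?gt_eqF.
  apply: (@le_trans _ _ (2 / m * ((5 / delta) ^+ size js *
      \sum_(0 <= i < K) r i * r i ^+ size js))).
    by apply: ler_wpM2l vsum; rewrite divr_ge0// ltW.
  rewrite mulrA ler_pM2l//; apply: le_trans sumr.
  have rE i : r i * r i ^+ size js = r i ^+ n by rewrite -exprS szjs.
  by apply: ler_sum => i _; rewrite rE.
- move=> t t01 Et; have [|i iK zr] := cov _ Et.
    move=> j; apply: le_trans (norm_coord_at _ _) _.
    apply: le_trans (ler_normD _ _) _; apply: lerD.
      by apply: le_trans (ler_normD _ _) _; rewrite lerD2l.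
    by have /andP[t0 t1] := t01; rewrite normrZ ger0_norm// ler_piMl.
  have zc j : `|coord_at a j + vc j + t * coord_at d j - coord_at (x i) j| < r i.
    apply: le_lt_trans zr; rewrite -vE -coord_atZ -!coord_atD -coord_atB.
    exact: norm_coord_at.
  have dk0 : coord_at d k != 0 by rewrite -normr_gt0.
  have tc : `|t - c i| < r i / m.
    rewrite ltr_pdivlMr// /m -normrM mulrBl /c divfK//.
    have := zc k; rewrite vck ?jsE ?eqxx// addr0 => h.
    by apply: le_lt_trans h; rewrite le_eqVlt; apply/orP; left; apply/eqP;
      congr `|_|; ring.
  exists (itv i); last by move: tc; rewrite ltr_norml /=; lra.
  apply/mapP; exists i => //; rewrite mem_filter mem_index_iota iK /= andbT.
  apply/allP => j _.
  have -> : vc j - y i j =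
      (coord_at a j + vc j + t * coord_at d j - coord_at (x i) j)
      - (t - c i) * coord_at d j by rewrite /y; ring.
  apply: le_lt_trans (ler_normB _ _) _; rewrite normrM.
  have : `|t - c i| * `|coord_at d j| <= r i.
    apply: (@le_trans _ _ (r i / m * m)); last by rewrite divfK ?gt_eqF.
    by apply: ler_pM => //; exact: ltW.
  by have := zc j; lra.
Qed.

End null_sets_and_lines.

(** * Assembling short paths between arbitrary points *)

Section metric_removability.
Local Open Scope ring_scope.
Context {R : realType} {n : nat}.
Let V := euclidean R n.
Implicit Types (a b d x y : V).

(** Remove an interval [J] containing the right end [q]. As [J] is open, the remaining intervals
    still cover [p, J.1], so induction applies. *)
Lemma covered_length_le (s : seq (R * R)) (p q : R) :
  all (fun I => I.1 < I.2) s ->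
  (forall t, p <= t <= q -> exists2 I, I \in s & I.1 < t < I.2) ->
  q - p <= total_length s.
Proof.
have [m] := ubnP (size s); elim: m s q => // m IH s q sm sP cov.
have ls0 : 0 <= total_length s.
  rewrite /total_length big_seq; apply: sumr_ge0 => I /(allP sP).
  by rewrite subr_ge0 => /ltW.
have [qp|pq] := ltP q p; first by lra.
have [|J Js qJ] := cov q; first by rewrite pq lexx.
have lenJ : total_length s = J.2 - J.1 + total_length (rem J s).
  by rewrite /total_length (big_rem J).
have srem : (size (rem J s)).+1 = size s.
  by rewrite size_rem// prednK//; case: (s) Js.
suff : J.1 - p <= total_length (rem J s) by rewrite lenJ; clear IH; lra.
apply: IH.
- by rewrite -ltnS srem.
- by apply/allP => I /(mem_subseq (rem_subseq J s)); apply: (allP sP).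
- move=> t tp; have [|I Is tI] := cov t; first by clear -tp qJ; lra.
  exists I => //; move: Is; rewrite (perm_mem (perm_to_rem Js)) in_cons.
  case/predU1P => // IJ; move: tI; rewrite IJ; clear -tp; lra.
Qed.

Variables (E : set V) (C : R).
Hypothesis clE : closed E.
Hypothesis nullE : hausdorff_measure n E = 0%E.
Hypothesis C0 : 0 < C.
Hypothesis bridge : forall x y, ~ E x -> ~ E y ->
  lipschitz_path (~` E) x y (C * `|y - x|).

(** Both ends lie on a shifted line that rarely meets [E], at times close to 0 and 1 when it is
    outside [E]; between them the path follows the line and bridges the bad intervals. *)
Lemma path_between_nearby_points a d (eps : R) : d != 0 -> 0 < eps ->
  exists a' b', [/\ ~ E a', ~ E b', `|a' - a| <= eps, `|b' - (a + d)| <= eps &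
    lipschitz_path (~` E) a' b' (`|d| + eps)].
Proof.
move=> d0 eps0; have nd := normr_ge0 d.
(* The three terms, times [eta], pay for the shift, for moving the end times, and for the bridges.
   The bound 1 / 2 on [eta] keeps the end times in order. *)
pose K := 1 + `|d| + C * `|d|.
have Cd : 0 <= C * `|d| by rewrite mulr_ge0// ltW.
have K0 : 0 < K by rewrite /K; lra.
pose eta := Num.min (1 / 2) (eps / K).
have eta0 : 0 < eta by rewrite lt_min !divr_gt0.
have eta1 : eta <= 1 / 2 by rewrite ge_min lexx.
have etaK : eta * K <= eps by rewrite -ler_pdivlMr// ge_min lexx orbT.
have etad : 0 <= eta * `|d| by rewrite mulr_ge0// ltW.
have etaC : 0 <= eta * (C * `|d|) by rewrite mulr_ge0// ltW.
have {etaK K0} etaK : eta + eta * `|d| + eta * (C * `|d|) <= eps.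
  by move: etaK; rewrite /K !mulrDr mulr1.
have eta20 : 0 < eta / 2 by rewrite divr_gt0.
have [v [s [veta sP slen cov]]] := null_set_line_cover E clE nullE a d (eta / 2) d0 eta20.
(* A window of length [eta] cannot be covered by intervals of total length [eta / 2]. *)
have exit p : 0 <= p -> p + eta <= 1 ->
    exists2 t, p <= t <= p + eta & ~ E (a + v + t *: d).
  move=> p0 p1; apply: contrapT => h.
  suff : p + eta - p <= total_length s by clear -slen eta0; lra.
  apply: covered_length_le => // t tp; apply: cov; first by clear -tp p0 p1; lra.
  by apply: contrapT => nEt; apply: h; exists t.
have [|t0 t0P t0E] := exit 0 (lexx 0); first by clear -eta1; lra.
have [||t1 t1P t1E] := exit (1 - eta); try by clear -eta1; lra.
have t01 : t0 <= t1 by clear -t0P t1P eta1; lra.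
have avK w : a + v + w - a = v + w.
  by rewrite addrAC (addrAC a) subrr add0r.
exists (a + v + t0 *: d), (a + v + t1 *: d); split=> //.
- rewrite avK; apply: le_trans (ler_normD _ _) _.
  rewrite normrZ ger0_norm; last by clear -t0P; lra.
  have : t0 * `|d| <= eta * `|d| by rewrite ler_wpM2r//; clear -t0P; lra.
  by clear -veta etaK etaC eta0; lra.
- have -> : a + v + t1 *: d - (a + d) = v - (1 - t1) *: d.
    by rewrite scalerBl scale1r opprD opprB !addrA avK.
  apply: le_trans (ler_normB _ _) _.
  rewrite normrZ ger0_norm; last by clear -t1P; lra.
  have : (1 - t1) * `|d| <= eta * `|d| by rewrite ler_wpM2r//; clear -t1P; lra.
  by clear -veta etaK etaC eta0; lra.
have sortP : perm_eq (sort (fun I J : R * R => I.1 <= J.1) s) s.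
  by rewrite perm_sort.
have slen' : total_length (sort (fun I J : R * R => I.1 <= J.1) s) <= eta.
  by rewrite /total_length (perm_big _ sortP) -/(total_length s); clear -slen eta0; lra.
have := path_along_line E C (a + v) d C0 bridge
  (sort (fun I J : R * R => I.1 <= J.1) s) t0 t1 t01 t0E t1E.
move=> H; apply: lipschitz_path_le (H _ _ _).
- have h1 : `|d| * (t1 - t0) <= `|d| * 1.
    by rewrite ler_wpM2l//; clear -t0P t1P; lra.
  have h2 : `|d| * (C * total_length (sort (fun I J : R * R => I.1 <= J.1) s)) <=
      `|d| * (C * eta) by rewrite ler_wpM2l// ler_wpM2l// ltW.
  rewrite mulrDr; move: h1 h2 etaK etad; clear -eta0; set z := total_length _; lra.
- by apply: sort_sorted => I J; exact: le_total.
- by rewrite (perm_all _ sortP).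
- move=> t tt Et; have [|I Is tI] := cov t _ Et; first by clear -tt t0P t1P; lra.
  by exists I; rewrite ?(perm_mem sortP).
Qed.

(** Points outside [E] are chosen within [rho k] of [a]. As [rho k] halves, consecutive ones are at
    most [3 * rho k.+1] apart, so bridging them costs [l / 2 ^+ k.+1], as [lipschitz_path_lim]
    requires. *)
Lemma path_to_endpoint a a' (l : R) : 0 < l ->
  (forall rho : R, 0 < rho -> exists2 x, ~ E x & `|x - a| <= rho) ->
  ~ E a' -> `|a' - a| <= l / (3 * C) ->
  lipschitz_path (~` E `|` [set a]) a' a l.
Proof.
move=> l0 dense a'E a'a; pose rho k : R := l / (3 * C) / 2 ^+ k.
have rho0 k : 0 < rho k by rewrite !divr_gt0 ?exprn_gt0// mulr_gt0.
have /choice[z zP] : forall k, exists x, ~ E x /\ `|x - a| <= rho k.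
  by move=> k; have [x xE xa] := dense _ (rho0 k); exists x.
pose x k := if k is 0%N then a' else z k.
have xE k : ~ E (x k) by case: k => [|k] //=; have [] := zP k.+1.
have xa k : `|x k - a| <= rho k.
  by case: k => [|k]; [rewrite /rho expr0 divr1|have [] := zP k.+1].
have rhoS k : rho k = 2 * rho k.+1.
  by rewrite /rho exprS; field; rewrite !gt_eqF ?exprn_gt0.
apply: (@lipschitz_path_lim _ _ _ x) => // [k|].
  apply: lipschitz_path_le (bridge _ _ (xE k) (xE k.+1)).
  have -> : l / 2 ^+ k.+1 = C * (3 * rho k.+1).
    by rewrite /rho; field; rewrite !gt_eqF ?exprn_gt0.
  rewrite ler_pM2l// -[x k.+1 - x k](subrKA a).
  apply: le_trans (ler_normD _ _) _; rewrite [`|a - x k|]distrC.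
  by have := xa k; have := xa k.+1; rewrite (rhoS k); lra.
apply/cvgrPdist_le => e e0.
have : geometric (rho 0%N) (2^-1 : R) @ \oo --> (0 : R).
  by apply: cvg_geometric; rewrite ger0_norm//; lra.
move=> /cvgrPdist_le/(_ _ e0); apply: filterS => k /=.
rewrite sub0r normrN ger0_norm; last first.
  by rewrite mulr_ge0 ?exprn_ge0 ?(ltW (rho0 0%N)).
rewrite exprVn {1}/rho expr0 divr1 -/(rho k) => ke.
by rewrite distrC; apply: le_trans (xa k) ke.
Qed.

Lemma short_path a b (eps : R) : 0 < eps ->
  lipschitz_path (~` E `|` [set a; b]) a b (`|a - b| + eps).
Proof.
move=> eps0; have [->|ab] := eqVneq b a.
  apply: (@lipschitz_path_le _ _ _ _ _ `|a - a|); first by rewrite lerDl ltW.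
  apply: lipschitz_path_segment => t _.
  by right; left; rewrite subrr scaler0 addr0.
have d0 : b - a != 0 by rewrite subr_eq0.
(* Density of the complement is read off from the starting points of the nearby paths, in the
   nonzero direction [b - a]. *)
have dense x (rho : R) : 0 < rho -> exists2 z, ~ E z & `|z - x| <= rho.
  move=> /(path_between_nearby_points x (b - a) rho d0)[z [_ [zE _ zx _ _]]].
  by exists z.
(* One third of [eps] goes to each end and one to the excess of the middle path. *)
pose l := eps / 3; have l0 : 0 < l by rewrite divr_gt0.
pose rho := Num.min l (l / (3 * C)).
have rho0 : 0 < rho by rewrite lt_min l0 divr_gt0// mulr_gt0.
have rhol : rho <= l by rewrite ge_min lexx.
have rhoC : rho <= l / (3 * C) by rewrite ge_min lexx orbT.
have [a' [b' [a'E b'E a'a b'b P]]] := path_between_nearby_points a (b - a) rho d0 rho0.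
rewrite (addrC a) subrK in b'b.
have Pa := path_to_endpoint a a' l l0 (dense a) a'E (le_trans a'a rhoC).
have Pb := path_to_endpoint b b' l l0 (dense b) b'E (le_trans b'b rhoC).
have sub x (S : set V) : S x -> ~` E `|` [set x] `<=` ~` E `|` S.
  by move=> Sx z [?|->]; [left|right].
apply: (@lipschitz_path_le _ _ _ _ _ (l + (`|b - a| + rho) + l)).
  by rewrite [`|a - b|]distrC; move: rhol; rewrite /l; set u := rho; lra.
apply: (@lipschitz_path_cat _ _ _ _ b').
  apply: (@lipschitz_path_cat _ _ _ _ a').
    apply: lipschitz_path_sym; apply: sub_lipschitz_path Pa.
    by apply: sub; left.
  by apply: sub_lipschitz_path P => z; left.
by apply: sub_lipschitz_path Pb; apply: sub; right.
Qed.

End metric_removability.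

Theorem proposition3p3 (R : realType) (n : nat) (E : set (euclidean R n)) :
  closed E ->
  hausdorff_measure n E = 0%E ->
  quasiconvex (~` E) ->
  metrically_removable E.
Proof.
move=> clE nullE qE eps eps0 a b.
have [C C0 bridge] := quasiconvex_lipschitz_path _ (closed_openC clE) qE.
have [alpha [beta [gamma [cg gA len]]]] :=
  lipschitz_path_curve _ _ _ _ (short_path E C clE nullE C0 bridge a b eps eps0).
exists alpha, beta, gamma; split=> //.
apply/seteqP; split=> // z [gz [Ez nab]].
by case: (gA _ gz).
Qed.
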